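(* For any graph $G$, $\chi_\ell^\bullet(G)\le \chi_c^\bullet(G)\le \Delta(G)+1$, where $\Delta(G)$ is the maximum degree of $G$.
   Context: A correspondence-cover of a graph $G$ is a pair $(L,H)$ where $H$ is a graph and $L:V(G)\to 2^{V(H)}$ is such that: the sets $L(v)$ partition $V(H)$; for distinct non-adjacent $u,v$ there are no edges of $H$ between $L(u)$ and $L(v)$; for $uv\in E(G)$ the edges of $H$ between $L(u)$ and $L(v)$ form a matching; each $L(v)$ induces a clique in $H$. It is $k$-fold if $|L(v)|=k$ for all $v$. A $k$-list-assignment $L$ assigns each vertex a set $L(v)\subseteq\mathbb{N}$ of size $k$; its list-cover has vertices $x_v$ ($v\in V(G)$, $x\in L(v)$), cliques on each $\{x_v:x\in L(v)\}$, and edges $x_ux_v$ for each $uv\in E(G)$ and $x\in L(u)\cap L(v)$; list-covers are in particular correspondence-covers. The fractional list packing number $\chi_\ell^\bullet(G)$ is the least integer $k$ such that every $k$-fold list-cover of $G$ (i.e. the list-cover of a $k$-list-assignment) has fractional chromatic number $k$. The fractional correspondence packing number $\chi_c^\bullet(G)$ is the least integer $k$ such that every $k$-fold correspondence-cover $(L,H)$ of $G$ has fractional chromatic number $\chi_f(H)=k$. *)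

(* Defs.v *)
From HB Require Import structures.
From mathcomp Require Import all_boot all_order all_algebra finmap.
From mathcomp Require Import classical_sets reals.

Set Implicit Arguments.
Unset Strict Implicit.
Unset Printing Implicit Defensive.

Import Order.TTheory GRing.Theory Num.Theory.

Local Open Scope ring_scope.

Record sgraph := SGraph {
  vertex :> finType;
  adj : rel vertex;
  adj_sym : symmetric adj;
  adj_irr : irreflexive adj }.

Section GraphNotions.
Variable G : sgraph.

Definition degree (v : G) : nat := #|[set u : G | adj v u]|.

Definition max_degree : nat := (\max_(v : G) degree v)%N.

Definition stable (I : {set G}) : bool :=
  [forall x in I, forall y in I, ~~ adj x y].

Definition clique (A : {set G}) : bool :=
  [forall x in A, forall y in A, (x != y) ==> adj x y].

Definition edges_between (A B : {set G}) : {set {set G}} :=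
  [set [set x; y] | x in A, y in B & adj x y].

Definition matching (M : {set {set G}}) : bool := finset.trivIset M.

End GraphNotions.

Section FractionalColouring.
Variables (R : realType) (H : sgraph).

(* Only the values of w on stable sets matter. *)
Definition fractional_colouring (w : {set H} -> R) : Prop :=
  (forall I, stable I -> 0 <= w I) /\
  (forall x : H, 1 <= \sum_(I : {set H} | stable I && (x \in I)) w I).

Definition total_weight (w : {set H} -> R) : R :=
  \sum_(I : {set H} | stable I) w I.

(* The infimum of a nonempty set of nonnegative reals, hence never the
   default value of inf. *)
Definition chi_f : R :=
  inf [set total_weight w | w in [set w | fractional_colouring w]]%classic.

End FractionalColouring.

Record correspondence_cover (G H : sgraph) (L : G -> {set H}) : Prop := {
  cover_disjoint : forall u v, u != v -> [disjoint L u & L v];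
  cover_total : forall x : H, exists v, x \in L v;
  cover_nonadj : forall u v, u != v -> ~~ adj u v ->
    edges_between (L u) (L v) = finset.set0;
  cover_matching : forall u v, adj u v ->
    matching (edges_between (L u) (L v));
  cover_clique : forall v, clique (L v) }.

Section ListCover.
Variables (G : sgraph) (L : G -> {fset nat}).

(* Tagged L x, for x : L v, is the vertex written x_v. *)
Definition list_cover_vertex : finType := {v : G & L v}.

Definition list_cover_adj : rel list_cover_vertex := fun a b =>
  ((tag a == tag b) && (a != b)) ||
  (adj (tag a) (tag b) && (val (tagged a) == val (tagged b))).

Fact list_cover_adj_sym : symmetric list_cover_adj.
Proof.
move=> a b; rewrite /list_cover_adj (eq_sym (tag a)) (eq_sym a) adj_sym.
by rewrite (eq_sym (val (tagged a))).
Qed.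

Fact list_cover_adj_irr : irreflexive list_cover_adj.
Proof. by move=> a; rewrite /list_cover_adj !eqxx adj_irr. Qed.

Definition list_cover : sgraph :=
  SGraph list_cover_adj_sym list_cover_adj_irr.

End ListCover.

Section PackingNumbers.
Variables (R : realType) (G : sgraph).

Definition list_packable (k : nat) : Prop :=
  forall L : G -> {fset nat},
    (forall v, #|` L v|%fset = k) -> chi_f R (list_cover L) = k%:R.

Definition correspondence_packable (k : nat) : Prop :=
  forall (H : sgraph) (L : G -> {set H}),
    correspondence_cover L -> (forall v, #|L v| = k) -> chi_f R H = k%:R.

(* k = 0 is excluded: a 0-fold cover is the empty graph, for which
   chi_f = 0, so every graph would satisfy the condition at 0. *)
Definition least_positive (P : nat -> Prop) (k : nat) : Prop :=
  [/\ (0 < k)%N, P k & forall j : nat, (0 < j)%N -> P j -> (k <= j)%N].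

Definition fractional_list_packing_number (k : nat) : Prop :=
  least_positive list_packable k.

Definition fractional_correspondence_packing_number (k : nat) : Prop :=
  least_positive correspondence_packable k.

End PackingNumbers.

(* Main.v *)
Require Import Defs.
From mathcomp Require Import all_boot all_order all_algebra finmap.
From mathcomp Require Import classical_sets reals.
From mathcomp Require Import boolp ring lra fintype finset.

(* A correspondence-cover H with lists of size k has clique number at least k,
   so only chi_f H <= k for k = Delta + 1 is at stake. By linear programming
   duality this means that for every weight w on the vertices of H some stable
   set has weight at least w(H) / k. Colour the vertices of G greedily in a
   uniformly random order, each with its heaviest available element: the number
   of earlier neighbours of v is uniform on 0, ..., deg v, so the expected weight
   obtained at v is at least the mean of the deg v + 1 <= k largest weights on
   its list, hence at least the mean over the whole list. *)

Set Implicit Arguments.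
Unset Strict Implicit.
Unset Printing Implicit Defensive.

Import Order.TTheory GRing.Theory Num.Theory.

Local Open Scope ring_scope.

(** * Fractional chromatic number: clique bound and linear programming duality *)

Section FractionalChromaticNumber.
Variables (R : realType) (H : sgraph).

Lemma chi_f_le_weight (w : {set H} -> R) :
  fractional_colouring w -> chi_f R H <= total_weight w.
Proof.
move=> hw; apply: ge_inf; last by exists w.
exists 0 => _ [w' [w'0 _] <-]; apply: sumr_ge0 => I sI; exact: w'0.
Qed.

Lemma fractional_colouring1 : fractional_colouring (fun _ : {set H} => 1 : R).
Proof.
split=> [I _|x]; first exact: ler01.
have sx : stable [set x].
  apply/forall_inP => y /set1P ->; apply/forall_inP => z /set1P ->.
  by rewrite adj_irr.
rewrite (bigD1 [set x]) /=; last by rewrite sx set11.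
by rewrite lerDl sumr_ge0.
Qed.

(** A stable set meets a clique at most once, so summing the covering constraints over [A] counts
    each [w I] at most once. *)
Lemma clique_le_chi_f (A : {set H}) : clique A -> #|A|%:R <= chi_f R H.
Proof.
move=> cA; apply: lb_le_inf.
  exists (total_weight (fun _ : {set H} => 1 : R)).
  by exists (fun=> 1) => //; exact: fractional_colouring1.
move=> _ [w [w0 w1] <-].
have -> : #|A|%:R = \sum_(x in A) (1 : R) by rewrite sumr_const.
apply: le_trans (ler_sum _ (fun x _ => w1 x)) _.
rewrite (exchange_big_dep (@stable H)) /=; last by move=> x I _ /andP[].
apply: ler_sum => I sI; rewrite sumr_const -[leRHS]mulr1n.
rewrite ler_wpMn2l ?w0 //.
apply/card_le1_eqP => x y.
move=> /andP[xA /andP[_ xI]] /andP[yA /andP[_ yI]].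
apply/eqP/negPn/negP => nxy.
move/forall_inP: cA => /(_ y yA)/forall_inP/(_ x xA); rewrite nxy /=.
by apply/negP; move/forall_inP: sI => /(_ y yI)/forall_inP/(_ x xI).
Qed.

Let cov (c : {set H} -> R) x := \sum_(I : {set H} | stable I && (x \in I)) c I.

(* Blackwell approachability: a stable set that answers the opposite of the
   current deviation vector does not increase its norm to first order, so
   after n steps the squared norm is only linear in n. *)
Lemma stable_sets_small_deviation (k : R) (n : nat) : 1 <= k ->
  (forall w : H -> R, exists2 I : {set H}, stable I &
     \sum_x w x <= k * \sum_(x in I) w x) ->
  exists c : {set H} -> R, [/\ forall I, 0 <= c I, total_weight c = n%:R &
    \sum_x (k * cov c x - n%:R) ^+ 2 <= n%:R * (#|H|%:R * k ^+ 2)].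
Proof.
move=> k1 hk; elim: n => [|n [c [c0 ctot cdev]]].
  exists (fun=> 0); split => //; first by rewrite /total_weight big1.
  by rewrite mul0r big1 // => x _; rewrite /cov big1 // mulr0 subr0 expr0n.
pose e x := k * cov c x - n%:R.
(* For [- e] the hypothesis says exactly that the increment [s] caused by adding [J] has nonpositive
   inner product with [e]. *)
have [J sJ hJ] := hk (fun x => - e x).
pose s x : R := k * (x \in J)%:R - 1.
have covE x : k * cov (fun I => c I + (I == J)%:R) x - n.+1%:R = e x + s x.
  rewrite /cov big_split /= -/(cov c x).
  have -> : \sum_(I : {set H} | stable I && (x \in I)) (I == J)%:R
              = (x \in J)%:R :> R.
    have [xJ|xJ] := boolP (x \in J).
      rewrite (bigD1 J) /= ?sJ // eqxx big1 ?addr0 // => I /andP[_].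
      by move/negPf ->.
    rewrite big1 // => I /andP[_ xI].
    by case: eqP => // IJ; rewrite -IJ xI in xJ.
  by rewrite /e /s -natr1; ring.
exists (fun I => c I + (I == J)%:R); split => [I||].
- by rewrite addr_ge0 ?ler0n.
- rewrite /total_weight big_split /= -/(total_weight c) ctot -natr1.
  congr (_ + _).
  by rewrite (bigD1 J) //= eqxx big1 ?addr0 // => I /andP[_ /negPf ->].
have es0 : \sum_x e x * s x <= 0.
  have -> : \sum_x e x * s x = k * (\sum_(x in J) e x) - \sum_x e x.
    rewrite (big_mkcond (fun x => x \in J)) mulr_sumr -sumrB.
    by apply: eq_bigr => x _; rewrite /s; case: (x \in J) => /=; ring.
  by move: hJ; rewrite !sumrN; lra.
have s2 : \sum_x s x ^+ 2 <= #|H|%:R * k ^+ 2.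
  have -> : #|H|%:R * k ^+ 2 = \sum_(x : H) k ^+ 2.
    by rewrite sumr_const mulr_natl.
  by apply: ler_sum => x _; rewrite /s; case: (x \in J) => /=; nra.
have -> : \sum_x (k * cov (fun I => c I + (I == J)%:R) x - n.+1%:R) ^+ 2
   = \sum_x e x ^+ 2 + 2 * (\sum_x e x * s x) + \sum_x s x ^+ 2.
  rewrite mulr_sumr -!big_split /=; apply: eq_bigr => x _.
  by rewrite covE; ring.
have : \sum_x e x ^+ 2 <= n%:R * (#|H|%:R * k ^+ 2) := cdev.
rewrite -natr1 mulrDl mul1r; lra.
Qed.

(* The linear programming dual of chi_f <= k. *)
Lemma chi_f_le (k : R) : 1 <= k ->
  (forall w : H -> R, exists2 I : {set H}, stable I &
     \sum_x w x <= k * \sum_(x in I) w x) ->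
  chi_f R H <= k.
Proof.
move=> k1 hk; apply/ler_addgt0Pr => eps eps0.
have k0 : 0 < k by lra.
(* The successor keeps [N] positive even if [H] is empty. *)
pose N : R := #|H|.+1%:R.
have N0 : 0 < N by rewrite ltr0n.
(* The final weight is [k q / (q - k) = k + k^2 / (q - k)]; this [q] makes the excess over [k] less
   than [eps]. *)
have [q hq] : exists q : nat, k + k ^+ 2 / eps < q%:R.
  exists (Num.truncn (k + k ^+ 2 / eps)).+1; exact: truncnS_gt.
have qk : k < q%:R.
  by apply: le_lt_trans hq; rewrite lerDl divr_ge0 ?sqr_ge0 // ltW.
(* After [N q^2] steps each coordinate deviates by at most [N q k], so [k * cov c x] is at least
   [N q (q - k)], and [c / m] covers every vertex. *)
have [c [c0 ctot cdev]] := stable_sets_small_deviation (#|H|.+1 * q ^ 2) k1 hk.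
rewrite natrM natrX -/N in ctot cdev.
pose m := N * q%:R * (q%:R - k) / k.
have m0 : 0 < m by rewrite divr_gt0 ?mulr_gt0 //; lra.
have cov_m x : m <= cov c x.
  have dev_x : (k * cov c x - N * q%:R ^+ 2) ^+ 2 <= (N * q%:R * k) ^+ 2.
    apply: (@le_trans _ _ (N * q%:R ^+ 2 * (#|H|%:R * k ^+ 2))).
      apply: le_trans cdev; rewrite (bigD1 x) //= lerDl.
      by rewrite sumr_ge0 // => ? _; rewrite sqr_ge0.
    have HN : #|H|%:R <= N by rewrite ler_nat.
    have -> : (N * q%:R * k) ^+ 2 = N * q%:R ^+ 2 * (N * k ^+ 2) by ring.
    by rewrite !ler_wpM2l ?ler_wpM2r ?mulr_ge0 ?sqr_ge0 // ltW.
  rewrite /m ler_pdivrMr //.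
  have Nqk : 0 <= N * q%:R * k by rewrite !mulr_ge0 // ltW.
  have : - (N * q%:R * k) <= k * cov c x - N * q%:R ^+ 2.
    rewrite leNgt; apply/negP => dev_lt; move: dev_x; apply/negP; rewrite -ltNge.
    set B := _ * k in Nqk dev_lt *; set A := _ - _ in dev_lt *; nra.
  by rewrite (mulrC _ k); lra.
have colouring : fractional_colouring (fun I => c I / m).
  split=> [I _|x]; first by rewrite divr_ge0 // ltW.
  by rewrite -mulr_suml ler_pdivlMr // mul1r; exact: cov_m.
apply: le_trans (chi_f_le_weight colouring) _.
rewrite /total_weight -mulr_suml -/(total_weight c) ctot.
have -> : N * q%:R ^+ 2 / m = k * q%:R / (q%:R - k) by rewrite /m; field; lra.
rewrite ler_pdivrMr; last lra.
have : eps * (k + k ^+ 2 / eps) <= eps * q%:R by rewrite ler_pM2l // ltW.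
rewrite mulrDr mulrCA divff; [nra | lra].
Qed.

End FractionalChromaticNumber.

(** * Heavy stable sets in a correspondence-cover *)

Lemma exists_ge0_sum (R : realFieldType) (T : finType) (U : {set T}) (F : T -> R) :
  U != set0 -> 0 <= \sum_(v in U) F v -> exists2 v, v \in U & 0 <= F v.
Proof.
move=> /set0Pn[v0 v0U] F0.
have [/exists_inP //|/exists_inPn nF] := boolP [exists v in U, 0 <= F v].
suff : \sum_(v in U) F v < \sum_(v in U) 0 by rewrite big1_eq ltNge F0.
apply: ltr_sum => [|v vU]; first by apply/hasP; exists v0; rewrite ?mem_index_enum.
by rewrite ltNge nF.
Qed.

Section HeavyStableSet.
Variables (R : realFieldType) (G H : sgraph) (L : G -> {set H}) (w : H -> R).
Hypothesis cover : correspondence_cover L.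

Lemma cover_adj (u v : G) (x y : H) :
  u != v -> x \in L u -> y \in L v -> adj x y -> adj u v.
Proof.
move=> uv xu yv xy; apply/negPn/negP => nuv.
have := cover_nonadj cover uv nuv; apply/eqP/set0Pn.
by exists [set x; y]; apply/imset2P; exists x y; rewrite ?inE ?yv.
Qed.

(** Two distinct edges at [x] would share [x], against the matching condition. *)
Lemma cover_adj_inj (u v : G) (x y z : H) :
  u != v -> x \in L u -> y \in L v -> z \in L v -> adj x y -> adj x z -> y = z.
Proof.
move=> uv xu yv zv xy xz.
have E t : t \in L v -> adj x t -> [set x; t] \in edges_between (L u) (L v).
  by move=> tv xt; apply/imset2P; exists x t; rewrite ?inE ?tv.
have /trivIsetP M := cover_matching cover (cover_adj uv xu yv xy).
have [exy|nxy] := eqVneq [set x; y] [set x; z].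
  have : y \in [set x; z] by rewrite -exy !inE eqxx orbT.
  by rewrite !inE => /orP[] /eqP // yx; rewrite yx adj_irr in xy.
have := M _ _ (E _ yv xy) (E _ zv xz) nxy.
by rewrite disjoint_subset => /subsetP/(_ x); rewrite !inE eqxx => /(_ isT).
Qed.

Let mean (A : {set H}) := (\sum_(x in A) w x) / #|A|%:R.

(** Deleting [z] lowers the mean by exactly [(w z - mean A) / (#|A| - 1)], where [w z <= t] and
    [d <= #|A| - 1]. *)
Lemma mean_setD1 (A : {set H}) (z : H) (t : R) (d : nat) :
  z \in A -> {in A, forall x, w x <= t} -> (0 < d < #|A|)%N ->
  - ((t - mean A) / d%:R) <= mean (A :\ z) - mean A.
Proof.
move=> zA wt /andP[d0 dA].
have cA : #|A|%:R = #|A :\ z|%:R + 1 :> R by rewrite (cardsD1 z A) zA addrC natrD.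
rewrite /mean cA (big_setD1 z zA) /=.
set S := \sum_(x in _) _; set m := #|A :\ z|%:R.
have dm : d%:R <= m by rewrite ler_nat; move: dA; rewrite (cardsD1 z A) zA.
have d0' : 0 < d%:R :> R by rewrite ltr0n.
have m0 : 0 < m by apply: lt_le_trans dm.
have St : S <= m * t.
  rewrite /m mulr_natl -sumr_const; apply: ler_sum => x /setD1P[_ xA]; exact: wt.
have wz := wt z zA.
have -> : S / m - (w z + S) / (m + 1) = - (((m * w z - S) / (m + 1)) / m).
  by field; lra.
have -> : t - (w z + S) / (m + 1) = ((m + 1) * t - w z - S) / (m + 1) by field; lra.
rewrite lerN2; set a := _ / (m + 1); set b := _ / (m + 1).
have ab : a <= b.
  rewrite ler_pM2r ?invr_gt0; last lra.
  suff : m * w z <= m * t by nra.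
  by rewrite ler_pM2l.
have b0 : 0 <= b by rewrite divr_ge0; nra.
apply: (@le_trans _ _ (b / m)); first by rewrite ler_pM2r // invr_gt0.
by rewrite ler_wpM2l // lef_pV2.
Qed.

(* Give a uniformly random v in U its heaviest element and delete the conflicts
   from the lists of its neighbours. With m and t the mean and the maximum of w
   on T u, the vertex u is v itself with probability 1/#|U| and then gains
   t - m; for each neighbour in U it loses at most (t - m) / (#|T u| - 1) with
   the same probability, and there are at most #|T u| - 1 neighbours. *)
Lemma heavy_stable_set (U : {set G}) (T : G -> {set H}) :
  (forall u, T u \subset L u) ->
  {in U, forall u, (#|[set v in U | adj u v]| < #|T u|)%N} ->
  exists I : {set H}, [/\ stable I, I \subset \bigcup_(u in U) T u &
    \sum_(u in U) mean (T u) <= \sum_(x in I) w x].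
Proof.
have [n] := ubnP #|U|; elim: n U T => // n IHn U T Un TL Tdeg.
have [->|U0] := eqVneq U set0.
  exists set0; rewrite !big_set0 sub0set; split => //.
  by apply/forall_inP => x; rewrite inE.
pose heaviest u x := u \in U -> x \in T u /\ {in T u, forall y, w y <= w x}.
have [top topP] : exists top : G -> H, forall u, heaviest u (top u).
  have ex u : u \in U -> exists x, x \in T u.
    move=> /Tdeg; case: (set_0Vmem (T u)) => [->|[x]]; first by rewrite cards0.
    by exists x.
  have [v0 /ex[h0 _]] := set0Pn _ U0.
  apply: (fin_all_exists (P := heaviest)) => u.
  have [uU|/negPf uU] := boolP (u \in U); last by exists h0; rewrite /heaviest uU.
  have [x xT] := ex _ uU.
  by exists [arg max_(y > x in T u) w y]%O => _; case: arg_maxP.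
(* Without a conflict [top u] is deleted instead, so that the list of every neighbour loses exactly
   one element. *)
pose z v u := odflt (top u) [pick y in T u | adj (top v) y].
have zT v u : u \in U -> z v u \in T u.
  move=> uU; rewrite /z; case: pickP => [y /andP[]|_] //=; by have [] := topP u uU.
pose T' v u := if adj v u then T u :\ z v u else T u.
pose d u := #|[set v in U | adj u v]|.
(* The change in collected weight plus remaining means when [v] takes [top v]; some [v] has it
   nonnegative because its sum over [U] is. *)
pose gain v := w (top v) - mean (T v) +
  \sum_(u in U | adj v u) (mean (T' v u) - mean (T u)).
have [v vU hv] : exists2 v, v \in U & 0 <= gain v.
  apply: (exists_ge0_sum U0); rewrite big_split /=.
  (* Regroup by the affected vertex [u] instead of the chosen vertex [v]. *)
  rewrite (exchange_big_dep (fun u => u \in U)) /=; last by move=> ? ? _ /andP[].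
  rewrite -big_split /=; apply: sumr_ge0 => u uU.
  have [tT wt] := topP u uU.
  have cT : 0 < #|T u|%:R :> R by rewrite ltr0n; apply: leq_trans (Tdeg u uU).
  have t0 : 0 <= w (top u) - mean (T u).
    rewrite subr_ge0 /mean ler_pdivrMr // mulr_natr -sumr_const.
    exact: ler_sum.
  rewrite uU /= -[leLHS](subrr (w (top u) - mean (T u))) lerD2l.
  apply: (@le_trans _ _ (\sum_(v in U | adj v u)
             - ((w (top u) - mean (T u)) / (d u)%:R))); last first.
    apply: ler_sum => v /andP[vU vu]; rewrite /T' vu.
    apply: mean_setD1 => //; first exact: zT.
    rewrite Tdeg // andbT card_gt0; apply/set0Pn; exists v.
    by rewrite inE vU adj_sym.
  have -> : \sum_(v in U | adj v u) - ((w (top u) - mean (T u)) / (d u)%:R)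
    = - ((w (top u) - mean (T u)) / (d u)%:R * (d u)%:R).
    rewrite sumr_const mulNrn mulr_natr; congr (- (_ *+ _)).
    by apply: eq_card => v; rewrite !inE adj_sym.
  rewrite lerN2.
  have [->|dn0] := eqVneq (d u) 0%N; first by rewrite mulr0.
  by rewrite divfK // pnatr_eq0.
have [xT _] := topP v vU; rewrite /gain in hv; set x := top v in xT hv.
have xL : x \in L v by apply: (subsetP (TL v)).
have [||| I [sI IT hI]] := IHn (U :\ v) (T' v).
- by move: Un; rewrite (cardsD1 v) vU.
- move=> u; rewrite /T'; case: ifP => // _.
  by apply: subset_trans (TL u); exact: subsetDl.
(* For a neighbour of [v], the degree inside [U] and the list size both drop by one; other vertices
   keep both. *)
- move=> u /setD1P[uv uU]; have := Tdeg u uU; rewrite /T'.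
  rewrite (cardsD1 v [set _ in U | _]) inE vU /= (adj_sym u v).
  have -> : [set t in U | adj u t] :\ v = [set t in U :\ v | adj u t].
    by apply/setP => t; rewrite !inE andbA.
  by case: ifP => // vu; rewrite (cardsD1 (z v u) (T u)) zT.
have far y : y \in I -> x != y /\ ~~ adj x y.
  move=> /(subsetP IT)/bigcupP[u /setD1P[uv uU] yT'].
  have yT : y \in T u by move: yT'; rewrite /T'; case: ifP => // _ /setD1P[].
  have yL := subsetP (TL u) y yT.
  have vu : v != u by rewrite eq_sym.
  split.
    apply/eqP => xy; have := cover_disjoint cover vu.
    by rewrite disjoint_subset => /subsetP/(_ x xL); rewrite inE xy yL.
  (* If [x] and [y] were adjacent, the matching condition would make [y] the element picked, hence
     deleted. *)
  apply/negP => xy; move: yT'; rewrite /T' (cover_adj vu xL yL xy) !inE /z.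
  case: pickP => [y' /andP[y'T xy'] /= /andP[/eqP[]]|/(_ y)]; last by rewrite yT xy.
  exact: (cover_adj_inj vu xL yL (subsetP (TL u) y' y'T)).
exists (x |: I); split.
- apply/forall_inP => a /setU1P aI; apply/forall_inP => b /setU1P bI.
  case: aI bI => [->|aI] [->|bI]; first by rewrite adj_irr.
  + by have [] := far b bI.
  + by rewrite adj_sym; have [] := far a aI.
  + by move/forall_inP: sI => /(_ a aI)/forall_inP/(_ b bI).
- apply/subsetP => y /setU1P[->|/(subsetP IT)/bigcupP[u /setD1P[uv uU] yT']].
    by apply/bigcupP; exists v.
  apply/bigcupP; exists u => //.
  by move: yT'; rewrite /T'; case: ifP => // _ /setD1P[].
have xI : x \notin I by apply/negP => /far[]; rewrite eqxx.
rewrite big_setU1 //=; apply: le_trans (lerD (lexx _) hI).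
rewrite (big_setD1 v vU) /= -lerBlDr -subr_ge0 opprB.
apply: le_trans hv _.
have -> : \sum_(u in U | adj v u) (mean (T' v u) - mean (T u))
   = \sum_(u in U :\ v) (mean (T' v u) - mean (T u)).
  rewrite big_mkcondr (big_setD1 v vU) /= adj_irr add0r; apply: eq_bigr => u _.
  by rewrite /T'; case: (adj v u); rewrite ?subrr.
rewrite sumrB; lra.
Qed.

End HeavyStableSet.

(** * The bound by the maximum degree *)

Section DegreeBound.
Variables (R : realType) (G : sgraph).

Lemma correspondence_packable_max_degree :
  (0 < #|G|)%N -> correspondence_packable R G (max_degree G).+1.
Proof.
move=> /card_gt0P[v0 _] H L cover cardL; set k := (max_degree G).+1.
apply/le_anti/andP; split; last first.
  by have := clique_le_chi_f R (cover_clique cover v0); rewrite cardL.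
apply: chi_f_le => [|w]; first by rewrite ler1n.
have k0 : 0 < k%:R :> R by rewrite ltr0n.
have [|u _|I [sI _ hI]] := heavy_stable_set w cover (U := [set: G]) (T := L).
- by [].
- rewrite cardL ltnS (_ : [set v in _ | _] = [set v | adj u v]).
    exact: (leq_bigmax u).
  by apply/setP => v; rewrite !inE.
exists I => //.
(* The lists partition [H] and all have size [k], so the sum of their means is the total weight over
   [k]. *)
rewrite mulrC -ler_pdivrMr //; apply: le_trans hI.
have -> : \sum_x w x = \sum_(x in \bigcup_v L v) w x.
  apply: eq_bigl => x; have [v xv] := cover_total cover x.
  by symmetry; apply/bigcupP; exists v.
rewrite partition_disjoint_bigcup; last exact: cover_disjoint.
rewrite mulr_suml [leRHS](eq_bigl xpredT); last by move=> u; rewrite inE.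
by apply: ler_sum => u _; rewrite cardL.
Qed.

(** * List-covers as correspondence-covers *)

Definition list_cover_part (L : G -> {fset nat}) (v : G) : {set list_cover L} :=
  [set a : list_cover L | tag a == v].

Lemma card_list_cover_part (L : G -> {fset nat}) (v : G) :
  #|list_cover_part L v| = #|` L v|%fset.
Proof.
have inj : injective (fun x : L v => Tagged (fun v => L v) x : list_cover L).
  by move=> x y /eqP; rewrite eq_Tagged => /eqP.
rewrite cardfE -cardsT -(card_imset _ inj); apply: eq_card => a; rewrite !inE.
apply/eqP/imsetP => [|[x _ ->] //].
by case: a => u x /= uv; case: _ / uv {inj} in x *; exists x.
Qed.

(** Edges between different parts join equal colours, and a colour determines its vertex within a
    part; hence edges sharing an end coincide. *)
Lemma list_cover_correspondence (L : G -> {fset nat}) :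
  correspondence_cover (list_cover_part L).
Proof.
have edge u v a b : u != v -> a \in list_cover_part L u ->
    b \in list_cover_part L v -> adj a b ->
    adj u v /\ val (tagged a) = val (tagged b).
  rewrite !inE => + /eqP au /eqP bv; subst u v.
  by rewrite /= /list_cover_adj => /negPf -> /andP[? /eqP].
split.
- move=> u v uv; rewrite disjoint_subset; apply/subsetP => a.
  by rewrite !inE => /eqP ->.
- by move=> a; exists (tag a); rewrite inE.
- move=> u v uv nadj; apply/setP => e; rewrite in_set0; apply/negbTE/negP.
  case/imset2P => a b au /=; rewrite inE => /andP[bv ab] _.
  by have [] := edge u v a b uv au bv ab; rewrite (negPf nadj).
- move=> u v uv_adj; have uv : u != v.
    by apply/eqP => uv; rewrite uv adj_irr in uv_adj.
  have eq_part t (a b : list_cover L) : a \in list_cover_part L t ->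
      b \in list_cover_part L t -> val (tagged a) = val (tagged b) -> a = b.
    rewrite !inE; case: a b => [s x] [s' y] /= /eqP ? /eqP ? xy; subst s s'.
    by congr existT; apply: val_inj.
  apply/trivIsetP => _ _ /imset2P[a b au + ->] /imset2P[a' b' a'u + ->].
  rewrite inE => /andP[bv ab]; rewrite inE => /andP[b'v a'b'] ne.
  have [_ vab] := edge u v a b uv au bv ab.
  have [_ va'b'] := edge u v a' b' uv a'u b'v a'b'.
  rewrite disjoint_subset; apply/subsetP => c c1; apply/negP => c2.
  have val_c : val (tagged a) = val (tagged a').
    move: c1 c2; rewrite !inE => /orP[]/eqP -> /orP[]/eqP.
    + by move=> ->.
    + by move=> E; rewrite E va'b'.
    + by move=> <-.
    + by move=> E; rewrite vab va'b' E.
  move/eqP: ne; apply; congr [set _; _]; first exact: (eq_part u).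
  by apply: (eq_part v); rewrite // -vab -va'b'.
- move=> v; apply/forall_inP => a; rewrite inE => /eqP av.
  apply/forall_inP => b; rewrite inE => /eqP bv; apply/implyP => ab.
  by apply/orP; left; rewrite av bv eqxx.
Qed.

Lemma correspondence_packable_list (k : nat) :
  correspondence_packable R G k -> list_packable R G k.
Proof.
move=> pk L cardL; apply: pk (list_cover_correspondence L) _ => v.
by rewrite card_list_cover_part.
Qed.

End DegreeBound.

(** * Existence and comparison of the packing numbers *)

Lemma least_positive_exists (P : nat -> Prop) (n : nat) :
  (0 < n)%N -> P n -> exists2 k, least_positive P k & (k <= n)%N.
Proof.
move=> n0 Pn.
have ex : exists k, (0 < k)%N && `[< P k >] by exists n; rewrite n0; apply/asboolP.
case: (ex_minnP ex) => k /andP[k0 /asboolP Pk] kmin.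
exists k; last by apply: kmin; rewrite n0; apply/asboolP.
by split=> // j j0 Pj; apply: kmin; rewrite j0; apply/asboolP.
Qed.

Theorem theorem7 (R : realType) (G : sgraph) (G_nonempty : (0 < #|G|)%N) :
  exists chi_l chi_c : nat,
    [/\ fractional_list_packing_number R G chi_l,
        fractional_correspondence_packing_number R G chi_c,
        (chi_l <= chi_c)%N
      & (chi_c <= (max_degree G).+1)%N].
Proof.
have [chi_c hc cD] := least_positive_exists (ltn0Sn _)
  (correspondence_packable_max_degree R G_nonempty).
have [c0 Pc _] := hc.
(* [chi_c] is itself list-packable, so the least such value is at most [chi_c]. *)
have [chi_l hl lc] := least_positive_exists c0 (correspondence_packable_list Pc).
by exists chi_l, chi_c.
Qed.
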